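(* Let $k$ be a knot in $S^3$ with knot group $G$, and let $K=G'$ be the commutator subgroup of $G$. Then there is a surjective homomorphism from $K$ to $\mathbb{Z}$ if and only if there is a non-constant factor of the Alexander polynomial of $k$ which is monic at both ends.
   Context: A knot in $S^3$ is a piecewise linear embedding of $S^1$ into $S^3$; its knot group $G$ is the fundamental group of its complement, and $G/G'\cong\mathbb{Z}$. The abelianisation $H_1(G';\mathbb{Z})$ is a finitely presented module over $\mathbb{Z}[t^{\pm1}]$, where $t$ acts by conjugation by an element of $G$ mapping to a generator of $G/G'$. The Alexander polynomial $\Delta(t)\in\mathbb{Z}[t^{\pm1}]$ is the highest common factor of the $m\times m$ minors of an $m\times n$ presentation matrix ($m$ generators, $m\le n$) of this module, defined up to multiplication by units $\pm t^k$. Factors are taken in $\mathbb{Z}[t^{\pm1}]$. The degree of a nonzero Laurent polynomial is the highest exponent of $t$ occurring minus the lowest, and non-constant means of positive degree. A Laurent polynomial is monic at both ends if the coefficients of its highest and of its lowest occurring powers of $t$ are both $\pm1$. *)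

(* Defs.v *)
From HB Require Import structures.
From mathcomp Require Import all_boot all_order all_algebra.
From mathcomp Require Import generic_quotient fraction.
From mathcomp Require Import mathcomp_extra boolp classical_sets functions.
From mathcomp Require Import reals topology normedtype.
From mathcomp Require Import ring lra.

Set Implicit Arguments.
Unset Strict Implicit.
Unset Printing Implicit Defensive.
Import Order.TTheory GRing.Theory Num.Theory.
Import numFieldNormedType.Exports.

Local Open Scope classical_set_scope.
Local Open Scope ring_scope.
Local Open Scope quotient_scope.

Section Derived.
Variable G : groupType.
Local Open Scope group_scope.

Definition derived : {pred G} := fun x =>
  `[< forall S : groupClosed G, (forall a b : G, [~ a, b] \in S) -> x \in S >].

Lemma derived_commg (a b : G) : [~ a, b] \in derived.
Proof. by rewrite unfold_in; apply/asboolP => S; apply. Qed.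

Fact derived_group_closed : group_closed derived.
Proof.
split=> [|x y]; rewrite !unfold_in.
  by apply/asboolP => S _; apply: gpred1.
move=> /asboolP hx /asboolP hy; apply/asboolP => S hS.
by apply: gpredF; [apply: hx|apply: hy].
Qed.

Fact derived_mul_closed : mulg_closed derived.
Proof. exact: group_closedM derived_group_closed. Qed.
Fact derived_inv_closed : invg_closed derived.
Proof. exact: group_closedV derived_group_closed. Qed.
Fact derived_1 : 1 \in derived.
Proof. exact: (fst derived_group_closed). Qed.

HB.instance Definition _ := isMulClosed.Build G derived derived_mul_closed.
HB.instance Definition _ := isMul1Closed.Build G derived derived_1.
HB.instance Definition _ := isInvClosed.Build G derived derived_inv_closed.

Lemma derivedJ (x y : G) : x \in derived -> x ^ y \in derived.
Proof.
move=> hx; have -> : x ^ y = x * [~ x, y] by rewrite /commg mulVKg.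
by apply: gpredM => //; apply: derived_commg.
Qed.

Record commutator_subgroup : Type :=
  CommutatorSubgroup { cs_val :> G; _ : cs_val \in derived }.
HB.instance Definition _ := [isSub for cs_val].
HB.instance Definition _ := [Choice of commutator_subgroup by <:].
HB.instance Definition _ :=
  SubChoice_isSubGroup.Build G derived commutator_subgroup derived_group_closed.

Definition derived_eq : rel G := fun x y => x^-1 * y \in derived.

Fact derived_eq_equiv : equiv_class_of derived_eq.
Proof.
split=> [x|x y|y x z]; rewrite /derived_eq.
- by rewrite mulVg gpred1.
- by rewrite -gpredV invgM invgK.
- move=> h1 h2; have -> : x^-1 * z = (x^-1 * y) * (y^-1 * z).
    by rewrite mulgA mulgK.
  exact: gpredM.
Qed.
Canonical derived_eq_rel := EquivRelPack derived_eq_equiv.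

Definition abelianisation : Type := {eq_quot derived_eq}.
HB.instance Definition _ := Choice.on abelianisation.
HB.instance Definition _ := Quotient.on abelianisation.
HB.instance Definition _ := EqQuotient.on abelianisation.

Definition ab (x : G) : abelianisation := \pi_abelianisation x.

Lemma abP (x y : G) : reflect (ab x = ab y) (x^-1 * y \in derived).
Proof. by rewrite -[_ \in _]/(derived_eq_rel x y) -eqmodE; apply: eqP. Qed.

Lemma abK (u : abelianisation) : ab (repr u) = u.
Proof. exact: reprK. Qed.

Definition ab_add (u v : abelianisation) := ab (repr u * repr v).
Definition ab_opp (u : abelianisation) := ab (repr u)^-1.

Lemma abC (x y : G) : ab (x * y) = ab (y * x).
Proof.
apply/abP; rewrite invgM -mulgA.
have -> : y^-1 * (x^-1 * (y * x)) = [~ y, x] by [].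
exact: derived_commg.
Qed.

Lemma ab_addE (x y : G) : ab_add (ab x) (ab y) = ab (x * y).
Proof.
have h u v w : ab u = ab v -> ab (w * u) = ab (w * v).
  by move/abP => huv; apply/abP; rewrite invgM -mulgA mulKg.
by rewrite /ab_add (h _ y) ?abK// abC (h _ x) ?abK// abC.
Qed.

Fact ab_addA : associative ab_add.
Proof.
move=> u v w; rewrite -[u]abK -[v]abK -[w]abK.
by rewrite !ab_addE mulgA.
Qed.

Fact ab_addC : commutative ab_add.
Proof. by move=> u v; rewrite /ab_add abC. Qed.

Fact ab_add0 : left_id (ab 1) ab_add.
Proof. by move=> u; rewrite -[u]abK ab_addE mul1g. Qed.

Fact ab_addN : left_inverse (ab 1) ab_opp ab_add.
Proof.
by move=> u; rewrite /ab_opp -{2}[u]abK ab_addE mulVg.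
Qed.

HB.instance Definition _ :=
  GRing.isZmodule.Build abelianisation ab_addA ab_addC ab_add0 ab_addN.

Lemma abM (x y : G) : ab (x * y) = (ab x + ab y)%R.
Proof. by rewrite -ab_addE. Qed.

Lemma ab1 : ab 1 = 0%R.
Proof. by []. Qed.

Lemma ab_eq0 (x : G) : (ab x = 0%R) <-> x \in derived.
Proof.
rewrite -ab1 -[x \in _]gpredV -[x^-1]mulg1; split; first by move/abP.
by move=> h; apply/abP.
Qed.

End Derived.
Arguments derived : clear implicits.

Section AbelianisationMap.
Variables (G H : groupType) (f : G -> H).
Hypothesis fM : {morph f : x y / (x * y)%g}.

Let preim_derived : {pred G} := fun x => f x \in derived H.

Let f1 : f 1%g = 1%g.
Proof. by apply: (mulgI (f 1%g)); rewrite -fM !mulg1. Qed.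

Let fV x : f x^-1%g = (f x)^-1%g.
Proof. by apply: (mulgI (f x)); rewrite -fM !mulgV f1. Qed.

Lemma derived_morph (x : G) : x \in derived G -> f x \in derived H.
Proof.
have inS u : (u \in preim_derived) = (f u \in derived H) by [].
have hM : mulg_closed preim_derived.
  by move=> u v; rewrite !inS fM => hu hv; apply: gpredM.
have h1 : 1%g \in preim_derived by rewrite inS f1 gpred1.
have hV : invg_closed preim_derived.
  by move=> u; rewrite !inS fV => hu; rewrite gpredV.
pose S : groupClosed G := HB.pack preim_derived
  (isMulClosed.Build G preim_derived hM) (isMul1Closed.Build G preim_derived h1)
  (isInvClosed.Build G preim_derived hV).
rewrite unfold_in => /asboolP /(_ S); apply => a b.
by rewrite inS /commg /conjg !(fM, fV); apply: derived_commg.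
Qed.

Definition ab_map (u : abelianisation G) : abelianisation H := ab (f (repr u)).

Lemma ab_mapE (x : G) : ab_map (ab x) = ab (f x).
Proof.
apply/abP; rewrite -fV -fM; apply: derived_morph.
by apply/abP; rewrite abK.
Qed.

Lemma ab_mapD : {morph ab_map : u v / u + v}.
Proof. by move=> u v; rewrite -[u]abK -[v]abK -abM !ab_mapE fM abM. Qed.

End AbelianisationMap.

Section ConjugationAction.
Variable G : groupType.
Local Notation K := (commutator_subgroup G).

Lemma derived_conj (t x : G) : x \in derived G -> (t * x * t^-1)%g \in derived G.
Proof.
move=> hx; have -> : (t * x * t^-1 = x ^ t^-1)%g by rewrite /conjg invgK mulgA.
exact: derivedJ.
Qed.

Definition conjK (t : G) (x : K) : K := CommutatorSubgroup (derived_conj t (valP x)).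

Lemma conjKM (t : G) : {morph conjK t : x y / (x * y)%g}.
Proof. by move=> x y; apply: val_inj; rewrite /= !mulgA mulgVK. Qed.

Lemma conjKK (t : G) : cancel (conjK t) (conjK t^-1%g).
Proof.
by move=> x; apply: val_inj; rewrite /= invgK !mulgA mulVg mul1g mulgVK.
Qed.

Definition H1conj (t : G) : abelianisation K -> abelianisation K :=
  ab_map (conjK t).

Lemma H1conjE (t : G) (x : K) : H1conj t (ab x) = ab (conjK t x).
Proof. exact: ab_mapE (conjKM t) x. Qed.

Lemma H1conjD (t : G) : {morph H1conj t : u v / u + v}.
Proof. exact: ab_mapD (conjKM t). Qed.

Lemma H1conjK (t : G) : cancel (H1conj t) (H1conj t^-1%g).
Proof. by move=> u; rewrite -[u]abK !H1conjE conjKK abK. Qed.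

Lemma H1conjVK (t : G) : cancel (H1conj t^-1%g) (H1conj t).
Proof. by move=> u; have := H1conjK t^-1%g u; rewrite invgK. Qed.

End ConjugationAction.

Local Notation "x %:F" := (FracField.tofrac x).

(* Laurent polynomials are the fractions p / t^n with p an integer polynomial. *)
Definition is_laurent : {pred {fraction {poly int}}} := fun x =>
  `[< exists (n : nat) (p : {poly int}), x * ('X%:F) ^+ n = p%:F >].

Fact is_laurent_subring : subring_closed is_laurent.
Proof.
split=> [|x y|x y]; rewrite !unfold_in.
- by apply/asboolP; exists 0%N, 1; rewrite expr0 mulr1 rmorph1.
- move=> /asboolP[n [p hp]] /asboolP[m [q hq]]; apply/asboolP.
  exists (n + m)%N, (p * 'X ^+ m - q * 'X ^+ n).
  rewrite rmorphB !rmorphM !rmorphXn/= -hp -hq mulrBl exprD.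
  by rewrite mulrA [_ ^+ n * _ ^+ m]mulrC mulrA.
- move=> /asboolP[n [p hp]] /asboolP[m [q hq]]; apply/asboolP.
  by exists (n + m)%N, (p * q); rewrite rmorphM/= -hp -hq exprD mulrACA.
Qed.

Record laurent : Type :=
  Laurent { laurent_val :> {fraction {poly int}}; _ : laurent_val \in is_laurent }.
HB.instance Definition _ := [isSub for laurent_val].
HB.instance Definition _ := [Choice of laurent by <:].
HB.instance Definition _ :=
  GRing.SubChoice_isSubComNzRing.Build _ is_laurent laurent is_laurent_subring.

Lemma tofracX_neq0 : ('X%:F : {fraction {poly int}}) != 0.
Proof. by rewrite tofrac_eq0 polyX_eq0. Qed.

Fact laurent_monomial_subproof (z : int) : ('X%:F : {fraction {poly int}}) ^ z \in is_laurent.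
Proof.
rewrite unfold_in; apply/asboolP; case: z => n.
  by exists 0%N, ('X ^+ n); rewrite mulr1 rmorphXn.
exists n.+1, 1; rewrite NegzE -exprnN mulVf ?rmorph1//.
by rewrite expf_neq0// tofracX_neq0.
Qed.

Definition laurent_monomial (z : int) : laurent := Laurent (laurent_monomial_subproof z).

Fact laurent_polyP (x : laurent) :
  {np : nat * {poly int} | val x * ('X%:F) ^+ np.1 = np.2%:F}.
Proof.
apply: cid; have := valP x; rewrite unfold_in => /asboolP[n [p h]].
by exists (n, p).
Qed.

(* An automorphism T of an abelian group M, with inverse T', makes M a
   Z[t, t^-1]-module on which t acts as T. *)
Section LaurentModule.
Variables (M : zmodType) (T T' : M -> M).

Definition laurent_module of {morph T : u v / u + v} & cancel T T' & cancel T' T :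
  Type := M.

Definition poly_act (p : {poly int}) (v : M) : M :=
  \sum_(i < size p) iter i T v *~ p`_i.

Definition laurent_act (x : laurent) (v : M) : M :=
  let: (n, p) := sval (laurent_polyP x) in iter n T' (poly_act p v).

Hypothesis TD : {morph T : u v / u + v}.
Hypothesis TK : cancel T T'.
Hypothesis T'K : cancel T' T.

Let T0 : T 0 = 0.
Proof. by apply: (addIr (T 0)); rewrite -TD !add0r. Qed.

Let TN u : T (- u) = - T u.
Proof. by apply: (addIr (T u)); rewrite -TD !addNr. Qed.

Let TMz (z : int) u : T (u *~ z) = T u *~ z.
Proof.
have TMn n : T (u *+ n) = T u *+ n.
  by elim: n => [|n IH]; rewrite ?mulr0n// !mulrS TD IH.
by case: z => n; rewrite ?NegzE ?mulrNz ?TN -!pmulrn TMn.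
Qed.

Let iterTD n : {morph iter n T : u v / u + v}.
Proof. by elim: n => [//|n IH] u v; rewrite !iterS IH TD. Qed.

Let iter0 n : iter n T 0 = 0.
Proof. by elim: n => [//|n IH]; rewrite iterS IH T0. Qed.

Let iterMz n (z : int) u : iter n T (u *~ z) = iter n T u *~ z.
Proof. by elim: n => [//|n IH]; rewrite !iterS IH TMz. Qed.

Let iterK n : cancel (iter n T') (iter n T).
Proof. by elim: n => [//|n IH] u; rewrite [iter _ T' _]iterS iterSr T'K IH. Qed.

Let iter_inj n : injective (iter n T).
Proof. by elim: n => [//|n IH] u v; rewrite !iterS => /(can_inj TK)/IH. Qed.

Let poly_actE n (p : {poly int}) v : (size p <= n)%N ->
  poly_act p v = \sum_(i < n) iter i T v *~ p`_i.
Proof.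
move=> hn; rewrite /poly_act -!(big_mkord xpredT (fun i => iter i T v *~ p`_i)).
rewrite (big_cat_nat (leq0n _) hn)/= [X in _ + X]big1_seq ?addr0// => i.
by rewrite mem_index_iota => /andP[_ /andP[hi _]]; rewrite nth_default// mulr0z.
Qed.

Let poly_actDl p q v : poly_act (p + q) v = poly_act p v + poly_act q v.
Proof.
pose n := maxn (size p) (size q).
rewrite !(@poly_actE n) ?leq_maxl ?leq_maxr// ?size_polyD// -big_split/=.
by apply: eq_bigr => i _; rewrite coefD mulrzDr.
Qed.

Let poly_act0 v : poly_act 0 v = 0.
Proof. by rewrite /poly_act size_poly0 big_ord0. Qed.

Let poly_actC c v : poly_act c%:P v = v *~ c.
Proof. by rewrite (@poly_actE 1) ?size_polyC_leq1// big_ord1 coefC. Qed.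

Let poly_actDr p u v : poly_act p (u + v) = poly_act p u + poly_act p v.
Proof.
rewrite /poly_act -big_split/=; apply: eq_bigr => i _.
by rewrite iterTD mulrzDl.
Qed.

Let poly_actX p v : poly_act (p * 'X) v = T (poly_act p v).
Proof.
rewrite (@poly_actE (size p).+1); last first.
  have [->|p0] := eqVneq p 0; first by rewrite mul0r size_poly0.
  by rewrite size_mulX.
rewrite big_ord_recl coefMX/= mulr0z add0r /poly_act (big_morph T TD T0).
by apply: eq_bigr => i _; rewrite coefMX/= TMz.
Qed.

Let poly_actXn n p v : poly_act (p * 'X ^+ n) v = iter n T (poly_act p v).
Proof.
elim: n => [|n IH]; first by rewrite mulr1.
by rewrite exprSr mulrA poly_actX IH.
Qed.

Let poly_act_comm p v : poly_act p (T v) = T (poly_act p v).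
Proof.
rewrite /poly_act (big_morph T TD T0); apply: eq_bigr => i _.
by rewrite TMz -iterSr.
Qed.

Let poly_act_iter n p v : poly_act p (iter n T v) = iter n T (poly_act p v).
Proof. by elim: n => [//|n IH]; rewrite !iterS poly_act_comm IH. Qed.

Let poly_actMz c p v : poly_act (p * c%:P) v = poly_act p (v *~ c).
Proof.
rewrite (@poly_actE (size p)); last first.
  by rewrite mulrC mul_polyC size_scale_leq.
by apply: eq_bigr => i _; rewrite coefMC iterMz -mulrzA mulrC.
Qed.

Let poly_actM p q v : poly_act (p * q) v = poly_act p (poly_act q v).
Proof.
elim/poly_ind: q => [|q c IH].
  rewrite mulr0 !poly_act0 /poly_act big1// => i _.
  by rewrite iter0 mul0rz.
rewrite mulrDr !poly_actDl mulrA !poly_actX IH poly_actDr poly_act_comm.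
by rewrite poly_actMz poly_actC.
Qed.

Lemma laurent_actE (x : laurent) n (p : {poly int}) v :
  val x * 'X%:F ^+ n = p%:F -> iter n T (laurent_act x v) = poly_act p v.
Proof.
rewrite /laurent_act; case: laurent_polyP => [[m q]] /= hq hp.
apply: (@iter_inj m); rewrite -iterD -[(m + n)%N]addnC iterD iterK.
rewrite -!poly_actXn; congr (poly_act _ v).
apply/eqP; rewrite -tofrac_eq !rmorphM !rmorphXn/= -hq -hp.
by rewrite mulrAC.
Qed.

Let laurent_act_inj (x : laurent) n (p : {poly int}) v w :
  val x * 'X%:F ^+ n = p%:F -> iter n T w = poly_act p v -> laurent_act x v = w.
Proof. by move=> hx hw; apply: (@iter_inj n); rewrite (laurent_actE _ hx). Qed.

Fact laurent_actA x y v :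
  laurent_act x (laurent_act y v) = laurent_act (x * y) v.
Proof.
have [[n p] /= hp] := laurent_polyP x; have [[m q] /= hq] := laurent_polyP y.
apply/esym/(@laurent_act_inj _ (m + n) (p * q)).
  by rewrite !rmorphM/= -hp -hq addnC exprD mulrACA.
rewrite iterD (laurent_actE _ hp) -poly_act_iter (laurent_actE _ hq).
by rewrite poly_actM.
Qed.

Fact laurent_act1 v : laurent_act 1 v = v.
Proof.
apply: (@laurent_act_inj _ 0 1); first by rewrite mulr1 rmorph1.
by rewrite poly_actC mulr1z.
Qed.

Fact laurent_actDr : right_distributive laurent_act +%R.
Proof.
move=> x u v; have [[n p] /= hp] := laurent_polyP x.
apply: (laurent_act_inj hp).
by rewrite iterTD !(laurent_actE _ hp) poly_actDr.
Qed.

Fact laurent_actDl v : {morph laurent_act^~ v : x y / x + y}.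
Proof.
move=> x y; have [[n p] /= hp] := laurent_polyP x.
have [[m q] /= hq] := laurent_polyP y.
apply: (@laurent_act_inj _ (m + n) (p * 'X ^+ m + q * 'X ^+ n)).
  rewrite !rmorphD !rmorphM !rmorphXn/= -hp -hq mulrDl exprD.
  by congr (_ + _); rewrite -mulrA// [_ ^+ n * _]mulrC.
rewrite iterTD [in iter (m + n) T (laurent_act y v)]addnC !iterD.
by rewrite (laurent_actE _ hp) (laurent_actE _ hq) poly_actDl !poly_actXn.
Qed.

Local Notation L := (laurent_module TD TK T'K).
HB.instance Definition _ := GRing.Zmodule.on L.
HB.instance Definition _ := GRing.Zmodule_isLmodule.Build laurent L
  laurent_actA laurent_act1 laurent_actDr laurent_actDl.

Lemma laurent_module_tE (v : L) : laurent_monomial 1 *: v = T v.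
Proof.
apply: (@laurent_act_inj _ 0 'X); first by rewrite mulr1.
by rewrite -['X]mul1r poly_actX poly_actC mulr1z.
Qed.

End LaurentModule.

Definition alexander_module (G : groupType) (t : G) : lmodType laurent :=
  laurent_module (H1conjD t) (H1conjK t) (H1conjVK t).

(* Rows of A are indexed by generators, columns by relations. *)
Definition is_presentation (R : comNzRingType) (M : lmodType R) (m n : nat)
    (A : 'M[R]_(m, n)) : Prop :=
  exists phi : {linear 'cV[R]_m -> M},
    (forall u, exists v, phi v = u) /\
    (forall v, phi v = 0 <-> exists w : 'cV[R]_n, v = A *m w).

Definition is_maximal_minor (R : comNzRingType) (m n : nat) (A : 'M[R]_(m, n))
    (x : R) : Prop :=
  exists2 f : 'I_m -> 'I_n, {homo f : i j / (i < j)%N} & x = \det (colsub f A).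

Definition divides (R : comNzRingType) (d x : R) : Prop := exists y, x = d * y.

Definition is_hcf (R : comNzRingType) (S : R -> Prop) (d : R) : Prop :=
  (forall x, S x -> divides d x) /\
  (forall e, (forall x, S x -> divides e x) -> divides e d).

(* The Alexander polynomial is only defined up to units, hence a relation. *)
Definition is_alexander_polynomial (G : groupType) (Delta : laurent) : Prop :=
  exists t : G,
    (forall u : abelianisation G, exists z : int, u = ab t *~ z) /\
    exists (m n : nat) (A : 'M[laurent]_(m, n)),
      [/\ (m <= n)%N, is_presentation (alexander_module t) A
        & is_hcf (is_maximal_minor A) Delta].

(* q is the sum of the c_i t^(a + i) for 0 <= i <= d, with c_0 and c_d
   nonzero: so q is nonzero, with lowest exponent a and degree d. *)
Definition is_expansion (q : laurent) (a : int) (d : nat) (c : nat -> int) : Prop :=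
  [/\ c 0 != 0, c d != 0
    & q = \sum_(i < d.+1) (c i)%:~R * laurent_monomial (a + i%:Z)].

Definition nonconstant (q : laurent) : Prop :=
  exists (a : int) (d : nat) (c : nat -> int), is_expansion q a d c /\ (0 < d)%N.

Definition monic_at_both_ends (q : laurent) : Prop :=
  exists (a : int) (d : nat) (c : nat -> int),
    [/\ is_expansion q a d c, `|c 0| = 1 & `|c d| = 1].

Section WithinContinuous.

Lemma within_comp (X Y Z : topologicalType) (A : set X) (B : set Y)
    (f : X -> Y) (g : Y -> Z) :
  {within A, continuous f} -> (forall x, A x -> B (f x)) ->
  {within B, continuous g} -> {within A, continuous (g \o f)}.
Proof.
move=> /continuousP cf fAB /continuousP cg; apply/continuousP => O oO.
have /open_subspaceP[V oV VE] := cg _ oO.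
have /open_subspaceP[W oW WE] := cf _ oV.
apply/open_subspaceP; exists W => //; rewrite WE.
apply/seteqP; split=> x [hx Ax]; split=> //.
- have : (V `&` B) (f x) by split=> //; exact: fAB.
  by rewrite VE => -[].
- have : ((g @^-1` O) `&` B) (f x) by split=> //; exact: fAB.
  by rewrite -VE => -[].
Qed.

Lemma within_glue (X Z : topologicalType) (A B C : set X) (h h1 h2 : X -> Z) :
  closed A -> closed B -> C `<=` A `|` B ->
  {within A, continuous h1} -> {within B, continuous h2} ->
  (forall x, A x -> h x = h1 x) -> (forall x, B x -> h x = h2 x) ->
  {within C, continuous h}.
Proof.
move=> cA cB CAB c1 c2 e1 e2; apply: (continuous_subspaceW CAB).
apply: withinU_continuous => //.
- by apply: subspace_eq_continuous c1 => x; rewrite inE => /e1.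
- by apply: subspace_eq_continuous c2 => x; rewrite inE => /e2.
Qed.

End WithinContinuous.

Local Ltac minmax_lra :=
  repeat match goal with
  | |- context [Order.min ?a ?b] =>
    lazymatch b with
    | context [Order.min _ _] => fail
    | _ => case: (leP a b) => ?
    end
  | |- context [Order.max ?a ?b] => case: (leP a b) => ?
  end; lra.

Section FundamentalGroup.
Variables (R : realType) (T : topologicalType) (x0 : T).
Local Notation I := (`[0, 1]%classic : set R).

(* Loops are total functions on R, of which only the restriction to [0, 1]
   matters: homotopic identifies loops that agree there. *)
Record loop : Type := Loop {
  loop_fun :> R -> T;
  loop_continuous : {within I, continuous loop_fun};
  loop0 : loop_fun 0 = x0;
  loop1 : loop_fun 1 = x0 }.

HB.instance Definition _ := gen_eqMixin loop.
HB.instance Definition _ := gen_choiceMixin loop.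

Definition homotopic (f g : loop) : Prop :=
  exists H : R * R -> T,
    [/\ {within I `*` I, continuous H},
        forall s, I s -> H (s, 0) = f s,
        forall s, I s -> H (s, 1) = g s
      & forall t, I t -> H (0, t) = x0 /\ H (1, t) = x0].

Let IP (s : R) : I s <-> 0 <= s <= 1.
Proof. by rewrite /= in_itv. Qed.

Let cst_cts : {within I, continuous (fun _ : R => x0)}.
Proof. by apply: continuous_subspaceT => x; apply: cst_continuous. Qed.

Definition loop_one : loop := Loop cst_cts erefl erefl.

Definition concat (f g : R -> T) (s : R) : T :=
  if s <= 1 / 2 then f (2 * s) else g (2 * s - 1).

Lemma concat_continuous (f g : loop) : {within I, continuous (concat f g)}.
Proof.
refine (@within_glue R T `[0, 1 / 2]%classic `[1 / 2, 1]%classic _ _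
  (f \o (fun s => 2 * s)) (g \o (fun s => 2 * s - 1)) _ _ _ _ _ _ _).
- exact: interval_closed.
- exact: interval_closed.
- move=> s /IP hs; have [h|h] := leP s (1 / 2); [left|right];
    rewrite /= in_itv/=; lra.
- apply: (within_comp _ _ (@loop_continuous f)).
    apply: continuous_subspaceT => s; exact: mulrl_continuous.
  by move=> s; rewrite /= !in_itv/=; lra.
- apply: (within_comp _ _ (@loop_continuous g)).
    apply: continuous_subspaceT => s; apply: continuousB; last exact: cst_continuous.
    exact: mulrl_continuous.
  by move=> s; rewrite /= !in_itv/=; lra.
- by move=> s; rewrite /= in_itv/= /concat => /andP[_ ->].
- move=> s; rewrite /= in_itv/= /concat => /andP[h _].
  case: ifPn => // h'; have -> : s = 1 / 2 by lra.
  have -> : 2 * (1 / 2) = 1 :> R by lra.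
  by rewrite subrr loop0 loop1.
Qed.

Lemma concat0 (f g : loop) : concat f g 0 = x0.
Proof. by rewrite /concat ifT; [rewrite mulr0 loop0|lra]. Qed.

Lemma concat1 (f g : loop) : concat f g 1 = x0.
Proof.
rewrite /concat ifF; last by lra.
by have -> : 2 * 1 - 1 = 1 :> R; [lra|rewrite loop1].
Qed.

Definition loop_mul (f g : loop) : loop :=
  Loop (@concat_continuous f g) (concat0 f g) (concat1 f g).

Let revcts : continuous (fun s : R => 1 - s).
Proof. by move=> s; apply: continuousB; [exact: cst_continuous|]. Qed.

Lemma reverse_continuous (f : loop) : {within I, continuous (f \o (fun s => 1 - s))}.
Proof.
apply: (within_comp _ _ (@loop_continuous f)).
  exact: continuous_subspaceT.
by move=> s /IP h; apply/IP; lra.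
Qed.

Lemma reverse0 (f : loop) : (f \o (fun s => 1 - s)) 0 = x0.
Proof. by rewrite /= subr0 loop1. Qed.

Lemma reverse1 (f : loop) : (f \o (fun s => 1 - s)) 1 = x0.
Proof. by rewrite /= subrr loop0. Qed.

Definition loop_inv (f : loop) : loop :=
  Loop (@reverse_continuous f) (reverse0 f) (reverse1 f).

Lemma homotopic_reparam (f p q : loop) (phi psi : R -> R) :
  continuous phi -> continuous psi ->
  (forall s, I s -> I (phi s)) -> (forall s, I s -> I (psi s)) ->
  phi 0 = psi 0 -> phi 1 = psi 1 ->
  (forall s, I s -> p s = f (phi s)) -> (forall s, I s -> q s = f (psi s)) ->
  homotopic p q.
Proof.
move=> cphi cpsi Iphi Ipsi h0 h1 hp hq.
exists (f \o (fun x => (1 - x.2) * phi x.1 + x.2 * psi x.1)); split.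
- apply: (within_comp _ _ (@loop_continuous f)).
    apply: continuous_subspaceT => x.
    have c1 : {for x, continuous (fun x : R * R => phi x.1)}.
      by apply: (@continuous_comp _ _ _ fst phi); [exact: cvg_fst|exact: cphi].
    have c2 : {for x, continuous (fun x : R * R => psi x.1)}.
      by apply: (@continuous_comp _ _ _ fst psi); [exact: cvg_fst|exact: cpsi].
    have c3 : {for x, continuous (fun x : R * R => x.2)} by exact: cvg_snd.
    have c4 : {for x, continuous (fun x : R * R => 1 - x.2)}.
      by apply: continuousB => //; exact: cst_continuous.
    exact: (continuousD (continuousM c4 c1) (continuousM c3 c2)).
  move=> [s t] [/= hs ht]; move/IP: (Iphi _ hs) => a; move/IP: (Ipsi _ hs) => b.
  by move/IP: ht => c; apply/IP; nra.
- by move=> s hs; rewrite /= subr0 mul1r mul0r addr0 hp.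
- by move=> s hs; rewrite /= subrr mul1r mul0r add0r hq.
- have I0 : I 0 by apply/IP; lra.
  have I1 : I 1 by apply/IP; lra.
  move=> t ht; rewrite /= -h0 -h1 -!mulrDl subrK !mul1r -!hp//.
  by rewrite loop0 loop1.
Qed.

Let cts_pair (a b : R -> R) : continuous a -> continuous b ->
  continuous (fun x : R * R => (a x.1, b x.2)).
Proof.
move=> ca cb x.
have c1 : {for x, continuous (fun x : R * R => a x.1)}.
  by apply: (@continuous_comp _ _ _ fst a); [exact: cvg_fst|exact: ca].
have c2 : {for x, continuous (fun x : R * R => b x.2)}.
  by apply: (@continuous_comp _ _ _ snd b); [exact: cvg_snd|exact: cb].
exact: (cvg_pair c1 c2).
Qed.

Let cts_id : continuous (fun s : R => s).
Proof. by move=> s. Qed.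

Lemma homotopic_refl f : homotopic f f.
Proof. by apply: (@homotopic_reparam f f f id id) => //; exact: cts_id. Qed.

Lemma homotopic_sym f g : homotopic f g -> homotopic g f.
Proof.
move=> [H [cH H0 H1 Hx]]; exists (H \o (fun x => (x.1, 1 - x.2))); split.
- apply: (within_comp _ _ cH).
    exact/continuous_subspaceT/(cts_pair cts_id revcts).
  by move=> [s t] [/= /IP hs /IP ht]; split; apply/IP => /=; lra.
- by move=> s hs; rewrite /= subr0 H1.
- by move=> s hs; rewrite /= subrr H0.
- by move=> t /IP ht; rewrite /=; apply: Hx; apply/IP; lra.
Qed.

Let closed_fst (S : set R) : closed S -> closed [set x : R * R | S x.1].
Proof. by move=> cS; apply: (preimage_closed _ cS) => x _; exact: cvg_fst. Qed.

Let closed_snd (S : set R) : closed S -> closed [set x : R * R | S x.2].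
Proof. by move=> cS; apply: (preimage_closed _ cS) => x _; exact: cvg_snd. Qed.

Let closed_rect (S S' : set R) : closed S -> closed S' -> closed (S `*` S').
Proof. by move=> cS cS'; apply: closedI; [exact: closed_fst|exact: closed_snd]. Qed.

Let cts_l : continuous (fun s : R => 2 * s).
Proof. by move=> s; exact: mulrl_continuous. Qed.

Let cts_r : continuous (fun s : R => 2 * s - 1).
Proof. by move=> s; apply: continuousB; [exact: cts_l|exact: cst_continuous]. Qed.

Lemma homotopic_trans f g h : homotopic f g -> homotopic g h -> homotopic f h.
Proof.
move=> [H [cH H0 H1 Hx]] [K [cK K0 K1 Kx]].
exists (fun x => if x.2 <= 1 / 2 then H (x.1, 2 * x.2) else K (x.1, 2 * x.2 - 1)).
split.
- refine (@within_glue (R * R)%type T (I `*` `[0, 1 / 2]%classic) (I `*` `[1 / 2, 1]%classic) _ _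
    (H \o (fun x => (x.1, 2 * x.2))) (K \o (fun x => (x.1, 2 * x.2 - 1))) _ _ _ _ _ _ _).
  + by apply: closed_rect; exact: interval_closed.
  + by apply: closed_rect; exact: interval_closed.
  + move=> [s t] [/= hs /IP ht]; have [?|?] := leP t (1 / 2); [left|right];
      split=> //=; rewrite in_itv/=; lra.
  + apply: (within_comp _ _ cH).
      exact/continuous_subspaceT/(cts_pair cts_id cts_l).
    move=> [s t] [/= hs]; rewrite in_itv/= => ht.
    by split=> //; apply/IP => /=; lra.
  + apply: (within_comp _ _ cK).
      exact/continuous_subspaceT/(cts_pair cts_id cts_r).
    move=> [s t] [/= hs]; rewrite in_itv/= => ht.
    by split=> //; apply/IP => /=; lra.
  + by move=> [s t] [/= hs]; rewrite in_itv/= => /andP[_ ->].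
  + move=> [s t] [/= hs]; rewrite in_itv/= => /andP[h1 _].
    case: ifPn => // h'; have -> : t = 1 / 2 by lra.
    have -> : 2 * (1 / 2) = 1 :> R by lra.
    by rewrite subrr H1// K0.
- by move=> s hs; rewrite /= ifT; [rewrite mulr0 H0|lra].
- move=> s hs; rewrite /= ifF; last by lra.
  by have -> : 2 * 1 - 1 = 1 :> R; [lra|rewrite K1].
- move=> t /IP ht /=; case: ifPn => h'.
    by apply: Hx; apply/IP; lra.
  by apply: Kx; apply/IP; lra.
Qed.

Lemma homotopic_mul f f' g g' : homotopic f f' -> homotopic g g' ->
  homotopic (loop_mul f g) (loop_mul f' g').
Proof.
move=> [H [cH H0 H1 Hx]] [K [cK K0 K1 Kx]].
exists (fun x => if x.1 <= 1 / 2 then H (2 * x.1, x.2) else K (2 * x.1 - 1, x.2)).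
split.
- refine (@within_glue (R * R)%type T (`[0, 1 / 2]%classic `*` I) (`[1 / 2, 1]%classic `*` I) _ _
    (H \o (fun x => (2 * x.1, x.2))) (K \o (fun x => (2 * x.1 - 1, x.2))) _ _ _ _ _ _ _).
  + by apply: closed_rect; exact: interval_closed.
  + by apply: closed_rect; exact: interval_closed.
  + move=> [s t] [/= /IP hs ht]; have [?|?] := leP s (1 / 2); [left|right];
      split=> //=; rewrite in_itv/=; lra.
  + apply: (within_comp _ _ cH).
      exact/continuous_subspaceT/(cts_pair cts_l cts_id).
    move=> [s t] [/= + ht]; rewrite in_itv/= => hs.
    by split=> //; apply/IP => /=; lra.
  + apply: (within_comp _ _ cK).
      exact/continuous_subspaceT/(cts_pair cts_r cts_id).
    move=> [s t] [/= + ht]; rewrite in_itv/= => hs.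
    by split=> //; apply/IP => /=; lra.
  + by move=> [s t] [/= + ht]; rewrite in_itv/= => /andP[_ ->].
  + move=> [s t] [/= + ht]; rewrite in_itv/= => /andP[h1 _].
    case: ifPn => // h'; have -> : s = 1 / 2 by lra.
    have -> : 2 * (1 / 2) = 1 :> R by lra.
    by rewrite subrr (Hx _ ht).2 (Kx _ ht).1.
- move=> s /IP hs; rewrite /= /concat; case: ifPn => h'.
    by apply: H0; apply/IP; lra.
  by apply: K0; apply/IP; lra.
- move=> s /IP hs; rewrite /= /concat; case: ifPn => h'.
    by apply: H1; apply/IP; lra.
  by apply: K1; apply/IP; lra.
- move=> t ht /=; rewrite ifT; last by lra.
  rewrite ifF; last by lra.
  have -> : 2 * 1 - 1 = 1 :> R by lra.
  by rewrite mulr0 (Hx _ ht).1 (Kx _ ht).2.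
Qed.

Lemma homotopic_inv f f' : homotopic f f' -> homotopic (loop_inv f) (loop_inv f').
Proof.
move=> [H [cH H0 H1 Hx]]; exists (H \o (fun x => (1 - x.1, x.2))); split.
- apply: (within_comp _ _ cH).
    exact/continuous_subspaceT/(cts_pair revcts cts_id).
  by move=> [s t] [/= /IP hs /IP ht]; split; apply/IP => /=; lra.
- by move=> s /IP hs; rewrite /= H0//; apply/IP; lra.
- by move=> s /IP hs; rewrite /= H1//; apply/IP; lra.
- by move=> t ht; rewrite /= subr0 subrr; have [] := Hx _ ht.
Qed.

Let cts_min (a b : R -> R) : continuous a -> continuous b ->
  continuous (fun s => Num.min (a s) (b s)).
Proof. by move=> ca cb s; apply: continuous_min; [exact: ca|exact: cb]. Qed.

Let cts_max (a b : R -> R) : continuous a -> continuous b ->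
  continuous (fun s => Num.max (a s) (b s)).
Proof. by move=> ca cb s; apply: continuous_max; [exact: ca|exact: cb]. Qed.

Let cts_cst (c : R) : continuous (fun _ : R => c).
Proof. by move=> s; exact: cst_continuous. Qed.

Let cts_aff (a b : R) : continuous (fun s : R => a * s + b).
Proof.
move=> s; apply: continuousD; last exact: cst_continuous.
exact: mulrl_continuous.
Qed.

Lemma loop_mulA f g h :
  homotopic (loop_mul f (loop_mul g h)) (loop_mul (loop_mul f g) h).
Proof.
apply: (@homotopic_reparam (loop_mul f (loop_mul g h)) _ _ id
  (fun s => Num.min (2 * s + 0) (Num.min (1 * s + 1 / 4) (1 / 2 * s + 1 / 2)))) => //.
- by apply: cts_min; [exact: cts_aff|apply: cts_min; exact: cts_aff].
- by move=> s /IP hs; apply/IP; minmax_lra.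
- by minmax_lra.
- by minmax_lra.
- move=> s /IP hs; rewrite /= /concat.
  have [h1|h1] := leP s (1 / 4).
    have -> : Num.min (2 * s + 0) (Num.min (1 * s + 1 / 4) (1 / 2 * s + 1 / 2)) = 2 * s.
      by minmax_lra.
    by rewrite !ifT//; lra.
  have [h2|h2] := leP s (1 / 2).
    have -> : Num.min (2 * s + 0) (Num.min (1 * s + 1 / 4) (1 / 2 * s + 1 / 2)) = s + 1 / 4.
      by minmax_lra.
    rewrite ifF; last by lra.
    rewrite [in RHS]ifF; last by lra.
    rewrite ifT; last by lra.
    by congr (g _); lra.
  have -> : Num.min (2 * s + 0) (Num.min (1 * s + 1 / 4) (1 / 2 * s + 1 / 2)) = 1 / 2 * s + 1 / 2.
    by minmax_lra.
  rewrite ifF; last by lra.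
  rewrite ifF; last by lra.
  by congr (h _); lra.
Qed.

Lemma loop_mul1 f : homotopic (loop_mul f loop_one) f.
Proof.
apply: (@homotopic_reparam f _ _ (fun s => Num.min (2 * s + 0) 1) id) => //.
- by apply: cts_min; [exact: cts_aff|exact: cts_cst].
- by move=> s /IP hs; apply/IP; minmax_lra.
- by minmax_lra.
- by minmax_lra.
- move=> s /IP hs; rewrite /= /concat; case: ifPn => h.
    by congr (f _); minmax_lra.
  have -> : Num.min (2 * s + 0) 1 = 1 by minmax_lra.
  by rewrite loop1.
Qed.

Lemma loop_1mul f : homotopic (loop_mul loop_one f) f.
Proof.
apply: (@homotopic_reparam f _ _ (fun s => Num.max (2 * s + -1) 0) id) => //.
- by apply: cts_max; [exact: cts_aff|exact: cts_cst].
- by move=> s /IP hs; apply/IP; minmax_lra.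
- by minmax_lra.
- by minmax_lra.
- move=> s /IP hs; rewrite /= /concat; case: ifPn => h.
    have -> : Num.max (2 * s + -1) 0 = 0 by minmax_lra.
    by rewrite loop0.
  by congr (f _); minmax_lra.
Qed.

Lemma loop_mulV f : homotopic (loop_mul f (loop_inv f)) loop_one.
Proof.
apply: (@homotopic_reparam f _ _
  (fun s => Num.min (2 * s + 0) (-2 * s + 2)) (fun=> 0)) => //.
- by apply: cts_min; exact: cts_aff.
- by move=> s /IP hs; apply/IP; minmax_lra.
- by move=> s /IP hs; apply/IP; lra.
- by minmax_lra.
- by minmax_lra.
- move=> s /IP hs; rewrite /= /concat; case: ifPn => h;
    by congr (f _); minmax_lra.
- by move=> s hs; rewrite loop0.
Qed.

Lemma loop_Vmul f : homotopic (loop_mul (loop_inv f) f) loop_one.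
Proof.
apply: (@homotopic_reparam f _ _
  (fun s => Num.max (2 * s + -1) (-2 * s + 1)) (fun=> 1)) => //.
- by apply: cts_max; exact: cts_aff.
- by move=> s /IP hs; apply/IP; minmax_lra.
- by move=> s /IP hs; apply/IP; lra.
- by minmax_lra.
- by minmax_lra.
- move=> s /IP hs; rewrite /= /concat; case: ifPn => h;
    by congr (f _); minmax_lra.
- by move=> s hs; rewrite loop1.
Qed.

Definition homotopicb : rel loop := fun f g => `[< homotopic f g >].

Fact homotopic_equiv : equiv_class_of homotopicb.
Proof.
split.
- by move=> f; apply/asboolP; exact: homotopic_refl.
- by move=> f g; apply/asboolP/asboolP; exact: homotopic_sym.
- move=> f g h /asboolP h1 /asboolP h2; apply/asboolP.
  exact: homotopic_trans h1 h2.
Qed.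
Canonical homotopic_equiv_rel := EquivRelPack homotopic_equiv.

Definition pi1 : Type := {eq_quot homotopicb}.
HB.instance Definition _ := Choice.on pi1.
HB.instance Definition _ := Quotient.on pi1.
HB.instance Definition _ := EqQuotient.on pi1.

Definition loop_class (f : loop) : pi1 := \pi_pi1 f.

Lemma loop_classP (f g : loop) : loop_class f = loop_class g <-> homotopic f g.
Proof.
rewrite /loop_class; split=> [/eqP|h]; last apply/eqP.
  by rewrite eqmodE => /asboolP.
by rewrite eqmodE; apply/asboolP.
Qed.

Lemma loop_classK (u : pi1) : loop_class (repr u) = u.
Proof. exact: reprK. Qed.

Let repr_homotopic (f : loop) : homotopic (repr (loop_class f)) f.
Proof. by apply/loop_classP; rewrite loop_classK. Qed.

Definition pi1_mul (u v : pi1) : pi1 := loop_class (loop_mul (repr u) (repr v)).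
Definition pi1_inv (u : pi1) : pi1 := loop_class (loop_inv (repr u)).

Let mulE f g : pi1_mul (loop_class f) (loop_class g) = loop_class (loop_mul f g).
Proof. by apply/loop_classP; apply: homotopic_mul; exact: repr_homotopic. Qed.

Let invE f : pi1_inv (loop_class f) = loop_class (loop_inv f).
Proof. by apply/loop_classP; apply: homotopic_inv; exact: repr_homotopic. Qed.

Fact pi1_mulA : associative pi1_mul.
Proof.
move=> u v w; rewrite -[u]loop_classK -[v]loop_classK -[w]loop_classK !mulE.
by apply/loop_classP; exact: loop_mulA.
Qed.

Fact pi1_1mul : left_id (loop_class loop_one) pi1_mul.
Proof.
move=> u; rewrite -{2}[u]loop_classK -[u in LHS]loop_classK mulE.
by apply/loop_classP; exact: loop_1mul.
Qed.

Fact pi1_mul1 : right_id (loop_class loop_one) pi1_mul.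
Proof.
move=> u; rewrite -{2}[u]loop_classK -[u in LHS]loop_classK mulE.
by apply/loop_classP; exact: loop_mul1.
Qed.

Fact pi1_Vmul : left_inverse (loop_class loop_one) pi1_inv pi1_mul.
Proof.
move=> u; rewrite -[u]loop_classK invE mulE.
by apply/loop_classP; exact: loop_Vmul.
Qed.

Fact pi1_mulV : right_inverse (loop_class loop_one) pi1_inv pi1_mul.
Proof.
move=> u; rewrite -[u]loop_classK invE mulE.
by apply/loop_classP; exact: loop_mulV.
Qed.

HB.instance Definition _ :=
  isGroup.Build pi1 pi1_mulA pi1_1mul pi1_mul1 pi1_Vmul pi1_mulV.

Lemma loop_classM f g :
  (loop_class f * loop_class g)%g = loop_class (loop_mul f g).
Proof. exact: mulE. Qed.

End FundamentalGroup.
Arguments pi1 R [T] x0.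

Section Knots.
Variable R : realType.

Definition convex_weights (n : nat) (l : 'I_n -> R) : Prop :=
  (forall i, 0 <= l i) /\ \sum_i l i = 1.

Definition polytope (E : lmodType R) (v : seq E) : set E :=
  [set x | exists2 l : 'I_(size v) -> R,
     convex_weights l & x = \sum_i l i *: v`_i].

Definition affine_on (E F : lmodType R) (v : seq E) (f : E -> F) : Prop :=
  forall l : 'I_(size v) -> R, convex_weights l ->
    f (\sum_i l i *: v`_i) = \sum_i l i *: f v`_i.

(* X is a finite union of convex polytopes on each of which f is affine; for a
   polyhedron X this amounts to f being linear on the simplices of some
   triangulation of X. *)
Definition piecewise_linear (E F : lmodType R) (X : set E) (f : E -> F) : Prop :=
  exists s : seq (seq E),
    X = [set x | exists2 v, v \in s & polytope v x] /\
    (forall v, v \in s -> affine_on v f).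

(* The norm on row vectors is the sup norm, so sphere n is the boundary of the
   cube [-1, 1]^(n+1), with its standard piecewise linear structure. *)
Definition sphere (n : nat) : set 'rV[R]_n.+1 := [set x | `|x| = 1].

(* As the circle is compact, an injective piecewise linear map is an embedding. *)
Record knot : Type := Knot {
  knot_fun :> 'rV[R]_2 -> 'rV[R]_4;
  knot_sphere : forall x, sphere x -> sphere (knot_fun x);
  knot_pl : piecewise_linear (@sphere 1) knot_fun;
  knot_inj : {in @sphere 1 &, injective knot_fun} }.

Definition complement (k : knot) : set 'rV[R]_4 :=
  @sphere 3 `\` (k @` @sphere 1).

Definition knot_group (k : knot) (x0 : complement k) : groupType := pi1 R x0.

End Knots.

(* Main.v *)
(* Let M be the Alexander module, A a presentation matrix of M, and L the ring of
   integer Laurent polynomials. A surjection K -> Z exists if and only if there is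
   a nonzero additive map F : M -> Z.

   Given F with F(v) <> 0, put phi(x) = F(x v) for x in L. The maximal minors of A
   kill M, hence lie in the ideal of all g with phi(L g) = 0. If they are not all
   zero, this ideal is generated by a primitive polynomial p of minimal degree d.
   The Hankel matrix (phi(t^(i+j))), i, j < d, has nonzero determinant D, and by
   the pigeonhole principle two windows (phi(t^(n+l))), l < d, agree modulo D for
   arbitrarily large n; so the ideal contains some t^j - t^i - g with i < j and g
   supported on exponents in [0, d), where d <= i. As p divides it, p has leading
   coefficient +-1; negative n give the lowest coefficient. Thus p divides all the
   minors, hence the Alexander polynomial. If the minors are all zero, so is the
   Alexander polynomial, and t - 1 will do.

   Conversely, if q divides all the maximal minors, McCoy's theorem over L / q gives
   a nonzero homomorphism M -> L / q; and L / q is a free abelian group when q is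
   monic at both ends. *)
From HB Require Import structures.
Require Import Defs.
From mathcomp Require Import all_boot all_order all_algebra.
From mathcomp Require Import perm fraction zify ring.
From mathcomp Require Import boolp classical_sets reals.

Set Implicit Arguments.
Unset Strict Implicit.
Unset Printing Implicit Defensive.
Import Order.TTheory GRing.Theory Num.Theory.
Local Open Scope ring_scope.

(** * Laurent polynomials *)

Section LaurentPolynomials.

Fact laurent_of_poly_subproof (p : {poly int}) : FracField.tofrac p \in is_laurent.
Proof. by rewrite unfold_in; apply/asboolP; exists 0%N, p; rewrite mulr1. Qed.

Definition laurent_of_poly (p : {poly int}) : laurent :=
  Laurent (laurent_of_poly_subproof p).

Fact laurent_of_poly_is_zmod_morphism : zmod_morphism laurent_of_poly.
Proof. by move=> p q; apply: val_inj; rewrite /= rmorphB. Qed.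

Fact laurent_of_poly_is_monoid_morphism : monoid_morphism laurent_of_poly.
Proof. by split=> [|p q]; apply: val_inj; rewrite /= ?rmorph1 ?rmorphM. Qed.

HB.instance Definition _ := GRing.isZmodMorphism.Build {poly int} laurent
  laurent_of_poly laurent_of_poly_is_zmod_morphism.
HB.instance Definition _ := GRing.isMonoidMorphism.Build {poly int} laurent
  laurent_of_poly laurent_of_poly_is_monoid_morphism.

Lemma laurent_of_poly_inj : injective laurent_of_poly.
Proof. by move=> p q /(congr1 val)/= /eqP; rewrite tofrac_eq => /eqP. Qed.

Lemma laurent_of_polyZ (c : int) (p : {poly int}) :
  laurent_of_poly (c *: p) = laurent_of_poly p *~ c.
Proof. by rewrite -[c in LHS]intz scaler_int raddfMz. Qed.

Lemma laurent_monomialD (a b : int) :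
  laurent_monomial (a + b) = laurent_monomial a * laurent_monomial b.
Proof. by apply: val_inj; rewrite /= expfzDr ?tofracX_neq0. Qed.

Lemma laurent_monomial_nat (n : nat) :
  laurent_monomial n%:Z = laurent_of_poly 'X^n.
Proof. by apply: val_inj; rewrite /= rmorphXn. Qed.

Lemma laurent_monomial0 : laurent_monomial 0 = 1.
Proof. by rewrite (laurent_monomial_nat 0) rmorph1. Qed.

Lemma laurent_monomialNK (a : int) :
  laurent_monomial (- a) * laurent_monomial a = 1.
Proof. by rewrite -laurent_monomialD addNr laurent_monomial0. Qed.

Lemma laurentE (x : laurent) :
  exists (n : nat) (p : {poly int}), x = laurent_monomial (- n%:Z) * laurent_of_poly p.
Proof.
have [[n p] /= hp] := laurent_polyP x; exists n, p.
have e : x * laurent_monomial n%:Z = laurent_of_poly p by apply: val_inj.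
by rewrite -e mulrCA laurent_monomialNK mulr1.
Qed.

(** A nonzero constant coefficient makes 0 the lowest exponent, which fixes the power of [t] in
    front. *)
Lemma laurent_poly_eqX (p q : {poly int}) (a b : int) :
  p`_0 != 0 -> q`_0 != 0 ->
  laurent_monomial a * laurent_of_poly p = laurent_monomial b * laurent_of_poly q ->
  p = q.
Proof.
have key (n : nat) (u v : {poly int}) : u`_0 != 0 ->
    laurent_of_poly u = laurent_monomial n%:Z * laurent_of_poly v -> u = v.
  move=> hu; rewrite laurent_monomial_nat -rmorphM => /laurent_of_poly_inj.
  case: n => [|n] e; first by rewrite e mul1r.
  by move: hu; rewrite e coefXnM.
wlog hab : a b p q / (a <= b)%R => [hw|] hp hq e.
  have [hab|/ltW hab] := leP a b; first exact: hw e.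
  by apply/esym; apply: hw (esym e).
apply: (key `|b - a|%N) => //.
have -> : `|b - a|%N%:Z = b - a by lia.
rewrite addrC laurent_monomialD -mulrA -e mulrA.
by rewrite laurent_monomialNK mul1r.
Qed.

Lemma is_expansion_poly (p : {poly int}) : p`_0 != 0 ->
  is_expansion (laurent_of_poly p) 0 (size p).-1 (fun i => p`_i).
Proof.
move=> hp; have p0 : p != 0 by apply: contraNneq hp => ->; rewrite coef0.
split=> //; first by rewrite -lead_coefE lead_coef_eq0.
rewrite prednK ?size_poly_gt0// -{1}[p]coefK poly_def raddf_sum /=.
apply: eq_bigr => i _; rewrite laurent_of_polyZ add0r laurent_monomial_nat.
by rewrite mulrzl.
Qed.

Lemma is_expansionE (q : laurent) a d c : is_expansion q a d c ->
  let p := \poly_(i < d.+1) c i in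
  [/\ q = laurent_monomial a * laurent_of_poly p, size p = d.+1, p`_0 != 0,
      p`_0 = c 0 & lead_coef p = c d].
Proof.
move=> [c0 cd ->] p; have hs : size p = d.+1 by rewrite size_poly_eq.
split=> //; last by rewrite lead_coefE hs coef_poly ltnSn.
- rewrite /p poly_def raddf_sum mulr_sumr /=; apply: eq_bigr => i _.
  by rewrite laurent_of_polyZ -laurent_monomial_nat laurent_monomialD mulrzl mulrzAr.
- by rewrite coef_poly.
- by rewrite coef_poly.
Qed.

(** The two hypotheses supply separate expansions; uniqueness of the polynomial part lets the degree
    of one go with the end coefficients of the other. *)
Lemma monic_at_both_endsP (q : laurent) : nonconstant q -> monic_at_both_ends q ->
  exists (a : int) (p : {poly int}),
    [/\ q = laurent_monomial a * laurent_of_poly p, (1 < size p)%N,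
        `|p`_0| = 1 & `|lead_coef p| = 1].
Proof.
move=> [a [d [c [/is_expansionE[q1 s1 n1 _ _] d0]]]].
move=> [b [e [g [/is_expansionE[q2 s2 n2 h0 hl] g0 gd]]]].
exists b, (\poly_(i < e.+1) g i); split=> //; rewrite ?h0 ?hl//.
have epoly := laurent_poly_eqX n1 n2 (etrans (esym q1) q2).
by rewrite -epoly s1 ltnS.
Qed.

Lemma nonconstant_poly (p : {poly int}) :
  p`_0 != 0 -> (1 < size p)%N -> nonconstant (laurent_of_poly p).
Proof.
move=> p0 hp; exists 0, (size p).-1, (fun i => p`_i).
by split; [exact: is_expansion_poly|lia].
Qed.

Lemma monic_at_both_ends_poly (p : {poly int}) :
  `|p`_0| = 1 -> `|lead_coef p| = 1 -> monic_at_both_ends (laurent_of_poly p).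
Proof.
move=> p0 pl; exists 0, (size p).-1, (fun i => p`_i); split=> //.
by apply: is_expansion_poly; rewrite -normr_eq0 p0.
Qed.

End LaurentPolynomials.

(** * Additive functionals on Laurent polynomials *)

Lemma nat_fin_collision (T : finType) (h : nat -> T) :
  exists i j : nat, (i < j)%N /\ h i = h j.
Proof.
have /injectivePn[i [j ij e]] :
    ~~ injectiveb (fun i : 'I_(#|T|.+1) => h i).
  apply/negP => /injectiveP/leq_card.
  by rewrite card_ord ltnn.
have [lt|lt|/val_inj eij] := ltngtP i j; first by exists i, j.
  by exists j, i.
by rewrite eij eqxx in ij.
Qed.

(** Pigeonhole on the vectors of residues modulo [D], which range over a finite set. *)
Lemma int_windows_collision (d : nat) (D : int) (u : nat -> 'rV[int]_d) : D != 0 ->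
  exists i j : nat, (i < j)%N /\ exists x : 'rV[int]_d, u j - u i = D *: x.
Proof.
move=> D0; pose res (c : int) : 'I_(`|D|%N.+1) := inord `|(c %% D)%Z|%N.
have em a b : res a = res b -> (a = b %[mod D])%Z.
  have ltD c : (`|(c %% D)%Z|%N < `|D|%N.+1)%N.
    by have := ltz_mod c D0; have := modz_ge0 c D0; lia.
  move/(congr1 val); rewrite /= !inordK// => h.
  by have := modz_ge0 a D0; have := modz_ge0 b D0; lia.
have [i [j [ij /ffunP e]]] :=
  nat_fin_collision (fun n => [ffun l => res (u n ord0 l)]).
exists i, j; split=> //.
exists (\row_l ((u j ord0 l - u i ord0 l) %/ D)%Z).
apply/rowP => l; rewrite !mxE mulrC.
have := e l; rewrite !ffunE => /em/esym/eqP.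
by rewrite eqz_mod_dvd => /divzK ->.
Qed.

Lemma int_mul_eq1 (a b : int) : a * b = 1 -> `|a| = 1.
Proof. by move/(congr1 absz); rewrite abszM => /eqP; rewrite muln_eq1; lia. Qed.

Section Functional.
Variable phi : {additive laurent -> int}.

(** These [g] form the largest ideal contained in the kernel of [phi]. *)
Definition annihilates (g : laurent) : Prop := forall h, phi (h * g) = 0.

Lemma annihilatesM (x g : laurent) : annihilates g -> annihilates (x * g).
Proof. by move=> hg h; rewrite mulrA. Qed.

Lemma annihilatesMz (g : laurent) (c : int) : c != 0 ->
  annihilates (g *~ c) -> annihilates g.
Proof.
move=> c0 hg h; apply/eqP; have := hg h.
by rewrite mulrzAr raddfMz /= -mulrzr intz => /eqP; rewrite mulf_eq0 (negPf c0) orbF.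
Qed.

Variable p : {poly int}.
Hypothesis p0 : p`_0 != 0.
Hypothesis p_ann : annihilates (laurent_of_poly p).

Let pN0 : p != 0.
Proof. by apply: contraNneq p0 => ->; rewrite coef0. Qed.

(* Dividing by p reduces nonnegative powers of t to the window; negative powers
   are reached by multiplying by p`_0 = p - t p'. *)
Lemma window_annihilates (w : laurent) :
  (forall j, (j < (size p).-1)%N -> phi (w * laurent_monomial j%:Z) = 0) ->
  annihilates w.
Proof.
move=> hw.
have hpoly P : phi (w * laurent_of_poly P) = 0.
  (* [p] is not yet known to be monic: pseudo-division scales [P] by a power of the leading
     coefficient, which is cancelled at the end because [int] is torsion-free. *)
  have c0 : lead_coef p ^+ scalp P p != 0 by rewrite expf_neq0 ?lead_coef_eq0.
  have : phi (w * laurent_of_poly (lead_coef p ^+ scalp P p *: P)) = 0.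
    rewrite Pdiv.Idomain.divp_eq rmorphD rmorphM mulrDr mulrA raddfD /= p_ann add0r.
    rewrite -[P %% p]coefK poly_def raddf_sum mulr_sumr raddf_sum /= big1// => i _.
    rewrite laurent_of_polyZ mulrzAr raddfMz /= -laurent_monomial_nat hw ?mul0rz//.
    rewrite -ltnS prednK ?size_poly_gt0//.
    exact: leq_ltn_trans (ltn_ord i) (Pdiv.Idomain.ltn_modpN0 P pN0).
  rewrite laurent_of_polyZ mulrzAr raddfMz /= -mulrzr intz => /eqP.
  by rewrite mulf_eq0 (negPf c0) orbF => /eqP.
suff hneg n P : phi (w * (laurent_monomial (- n%:Z) * laurent_of_poly P)) = 0.
  by move=> h; have [n [P ->]] := laurentE h; rewrite mulrC.
elim: n P => [|n IH] P; first by rewrite oppr0 laurent_monomial0 mul1r.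
have /factor_theorem[p' hp'] : root (p - (p`_0)%:P) 0.
  by rewrite rootE hornerD hornerN hornerC horner_coef0 subrr.
rewrite subr0 in hp'.
have eP : P * (p`_0)%:P = P * p - P * p' * 'X.
  by rewrite -mulrA -hp' -mulrBr opprB addrC subrK.
set m := laurent_monomial _.
have : phi (w * (m * laurent_of_poly (P * (p`_0)%:P))) = 0.
  have eX : m * laurent_of_poly 'X = laurent_monomial (- n%:Z).
    rewrite -['X]expr1 -laurent_monomial_nat -laurent_monomialD.
    by congr laurent_monomial; lia.
  have -> : w * (m * laurent_of_poly (P * (p`_0)%:P)) =
      (w * m * laurent_of_poly P) * laurent_of_poly p
      - w * (m * laurent_of_poly 'X * laurent_of_poly (P * p')).
    by rewrite eP rmorphB !rmorphM /=; ring.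
  by rewrite raddfB /= p_ann eX IH subr0.
rewrite [P * _]mulrC mul_polyC laurent_of_polyZ !mulrzAr raddfMz /= -mulrzr intz => /eqP.
by rewrite mulf_eq0 (negPf p0) orbF => /eqP.
Qed.

Hypothesis p_min : forall g : {poly int}, g != 0 ->
  annihilates (laurent_of_poly g) -> (size p <= size g)%N.

(** The pseudo-remainder also annihilates and is shorter than [p], so it vanishes. Here [%|] is
    divisibility up to a nonzero integer factor. *)
Lemma annihilates_dvdp (g : {poly int}) : annihilates (laurent_of_poly g) -> p %| g.
Proof.
move=> hg; apply: contraT => r0; have := Pdiv.Idomain.ltn_modpN0 g pN0.
rewrite ltnNge p_min// => h.
rewrite -(addKr ((g %/ p) * p) (g %% p)) -Pdiv.Idomain.divp_eq addrC.
rewrite rmorphB rmorphM /= laurent_of_polyZ mulrBr raddfB /= mulrA p_ann subr0.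
by rewrite mulrzAr raddfMz /= hg mul0rz.
Qed.

Let d := (size p).-1.
(** The Gram matrix of the form [phi (x * y)] in the powers of [t] with exponents from 0 to
    [d - 1]. *)
Definition hankel : 'M[int]_d := \matrix_(i, j) phi (laurent_monomial (i + j)%N%:Z).

Lemma functional_window (v : 'rV[int]_d) (j : 'I_d) :
  phi (laurent_of_poly (rVpoly v) * laurent_monomial j%:Z) = (v *m hankel) ord0 j.
Proof.
rewrite mxE /rVpoly poly_def raddf_sum mulr_suml raddf_sum /=.
apply: eq_bigr => i _; rewrite insubT //= => lti.
rewrite mxE laurent_of_polyZ -laurent_monomial_nat mulrzAl -laurent_monomialD.
rewrite raddfMz /= -mulrzl intz; congr (v _ _ * _); exact: val_inj.
Qed.

(** A kernel vector would be a nonzero polynomial of size at most [d] with vanishing window, hence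
    an annihilator shorter than [p]. *)
Lemma hankel_det_neq0 : \det hankel != 0.
Proof.
apply/det0P => -[v v0 vH].
have g0 : rVpoly v != 0.
  by apply: contra_neq v0 => g0; rewrite -[v]rVpolyK g0 raddf0.
suff /(p_min g0) hv : annihilates (laurent_of_poly (rVpoly v)).
  by have := leq_trans hv (size_poly _ _); rewrite leqNgt ltn_predL size_poly_gt0 pN0.
apply: window_annihilates => j hj.
by rewrite (functional_window v (Ordinal hj)) vH mxE.
Qed.

(** The exponents [e] are left free so that they can tend to either infinity, one for each end of
    [p]. *)
Lemma annihilates_relation (e : nat -> int) :
  exists i j : nat, (i < j)%N /\ exists g : {poly int}, (size g <= d)%N /\
    annihilates (laurent_monomial (e j) - laurent_monomial (e i) - laurent_of_poly g).
Proof.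
pose u n : 'rV[int]_d := \row_l phi (laurent_monomial (e n + l%:Z)).
have [i [j [ij [x hx]]]] := int_windows_collision u hankel_det_neq0.
(* Multiplying the adjugate by [hankel] gives the determinant, so this polynomial has the same
   window as the difference of the two monomials. *)
exists i, j; split=> //; exists (rVpoly (x *m \adj hankel)).
split; first exact: size_poly.
apply: window_annihilates => l hl.
rewrite !mulrBl !raddfB /= (functional_window _ (Ordinal hl)) -mulmxA mul_adj_mx.
rewrite mul_mx_scalar -hx !mxE -!laurent_monomialD.
exact: subrr.
Qed.

Lemma annihilator_lead_coef : zprimitive p = p -> `|lead_coef p| = 1.
Proof.
(* Exponents from [d] on exceed the degree of [g], so the relation has leading coefficient 1; as [p]
   is primitive, it divides the relation over the integers. *)
move=> p_prim; have [i [j [ij [g [sg]]]]] := annihilates_relation (fun n => (d + n)%:Z).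
rewrite !laurent_monomial_nat -!rmorphB => /annihilates_dvdp/dvdpP_int[r].
rewrite p_prim => /(congr1 lead_coef); rewrite lead_coefM -addrA lead_coefDl.
  by rewrite lead_coefXn => /esym/int_mul_eq1.
rewrite -opprD size_polyN size_polyXn; apply: leq_ltn_trans (size_polyD _ _) _.
rewrite gtn_max !size_polyXn !ltnS ltn_add2l ij /=.
exact: leq_trans sg (leq_addr _ _).
Qed.

Lemma annihilator_coef0 : zprimitive p = p -> `|p`_0| = 1.
Proof.
(* With these negative exponents, multiplying by [t^(j+1)] turns the relation into
   [1 - t^(j-i) - t^(j+1) g], of constant coefficient 1. *)
move=> p_prim; have [i [j [ij [g [_]]]]] := annihilates_relation (fun n => - n.+1%:Z).
move/(annihilatesM (laurent_monomial j.+1%:Z)).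
rewrite !mulrBr -!laurent_monomialD.
have -> : j.+1%:Z + - j.+1%:Z = 0%N by rewrite subrr.
have -> : j.+1%:Z + - i.+1%:Z = (j - i)%N by lia.
rewrite !laurent_monomial_nat -rmorphM -!rmorphB => /annihilates_dvdp/dvdpP_int[r].
rewrite p_prim => /(congr1 (fun q : {poly int} => q`_0)).
rewrite coef0M !coefB coefXn coefXnM coefXn /= eqn_leq.
have -> : (j - i <= 0)%N = false by lia.
by rewrite andbF !subr0 => /esym/int_mul_eq1.
Qed.

End Functional.

Lemma annihilator_generator (phi : {additive laurent -> int}) (c : laurent) :
  c != 0 -> annihilates phi c -> phi 1 != 0 ->
  exists q : laurent, [/\ nonconstant q, monic_at_both_ends q &
    forall g, annihilates phi g -> divides q g].
Proof.
move=> c0 hc phi1.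
have poly_of g : annihilates phi g -> exists n (P : {poly int}),
    g = laurent_monomial (- n%:Z) * laurent_of_poly P /\
    annihilates phi (laurent_of_poly P).
  have [n [P eP]] := laurentE g => hg; exists n, P; split=> //.
  have -> : laurent_of_poly P = laurent_monomial n%:Z * g.
    by rewrite eP mulrA [laurent_monomial n * _]mulrC laurent_monomialNK mul1r.
  exact: annihilatesM.
pose Q k := `[< exists p : {poly int},
  [/\ p != 0, annihilates phi (laurent_of_poly p) & size p = k] >].
have exQ : exists k, Q k.
  have [n [P [eP hP]]] := poly_of _ hc; exists (size P); apply/asboolP; exists P.
  by split=> //; apply: contraNneq c0 => P0; rewrite eP P0 raddf0 mulr0.
have [k /asboolP[p1 [p10 ann1 size1]] k_min] := ex_minnP exQ.
pose p := zprimitive p1.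
have pN0 : p != 0 by rewrite zprimitive_eq0.
have p_ann : annihilates phi (laurent_of_poly p).
  apply: (@annihilatesMz _ _ (zcontents p1)); first by rewrite zcontents_eq0.
  by rewrite -laurent_of_polyZ -zpolyEprim.
have p_min g : g != 0 -> annihilates phi (laurent_of_poly g) -> (size p <= size g)%N.
  move=> g0 hg; rewrite size_zprimitive size1; apply: k_min.
  by apply/asboolP; exists g.
have p_prim : zprimitive p = p by exact: zprimitive_id.
(* Otherwise [p / t] would be a shorter annihilator, [t] being a unit. *)
have p0 : p`_0 != 0.
  rewrite -horner_coef0 -rootE; apply/negP => /factor_theorem[q].
  rewrite subr0 => eq.
  have q0 : q != 0 by apply: contraNneq pN0 => q0; rewrite eq q0 mul0r.
  have : annihilates phi (laurent_of_poly q).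
    have -> : laurent_of_poly q = laurent_monomial (- 1%:Z) * laurent_of_poly p.
      by rewrite eq rmorphM /= mulrCA -['X]expr1 -laurent_monomial_nat
        laurent_monomialNK mulr1.
    exact: annihilatesM.
  by move/(p_min _ q0); rewrite eq size_mulX// ltnn.
have lead1 := annihilator_lead_coef p0 p_ann p_min p_prim.
have low1 := annihilator_coef0 p0 p_ann p_min p_prim.
have dvd g : annihilates phi g -> divides (laurent_of_poly p) g.
  move=> /poly_of[n [P [-> /(annihilates_dvdp p0 p_ann p_min)/dvdpP_int[r ->]]]].
  by rewrite p_prim rmorphM mulrCA; eexists.
(* A constant [p] would put 1 into the ideal, against [phi 1 != 0]. *)
exists (laurent_of_poly p); split=> //; last exact: monic_at_both_ends_poly.
apply: nonconstant_poly => //; rewrite ltnNge; apply/negP => /size1_polyC ep.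
have : annihilates phi 1.
  apply: (annihilatesMz p0); rewrite -(rmorph1 laurent_of_poly) -laurent_of_polyZ.
  by rewrite alg_polyC -ep.
by move/(_ 1); rewrite mulr1 => e; rewrite e in phi1.
Qed.

(** * Row relations modulo an ideal *)

Section Divides.
Variables (S : comNzRingType) (q : S).

Lemma divides0 : divides q 0.
Proof. by exists 0; rewrite mulr0. Qed.

Lemma dividesMl (x y : S) : divides q x -> divides q (y * x).
Proof. by move=> [z ->]; exists (y * z); rewrite mulrCA. Qed.

Lemma dividesD (x y : S) : divides q x -> divides q y -> divides q (x + y).
Proof. by move=> [u ->] [v ->]; exists (u + v); rewrite mulrDr. Qed.

Lemma dividesB (x y : S) : divides q x -> divides q y -> divides q (x - y).
Proof. by move=> [u ->] [v ->]; exists (u - v); rewrite mulrBr. Qed.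

Lemma divides_sign (b : bool) (x : S) : divides q ((-1) ^+ b * x) -> divides q x.
Proof. by move/(dividesMl ((-1) ^+ b)); rewrite mulrA -signr_addb addbb mul1r. Qed.

End Divides.

Section McCoy.
Variables (S : comNzRingType) (q : S) (m n : nat) (A : 'M[S]_(m, n)).

Lemma det_row_inj (k : nat) (B : 'M[S]_k) (T : finType) (f : 'I_k -> T)
    (g : T -> 'I_k -> S) :
  (forall i j, B i j = g (f i) j) -> ~~ injectiveb f -> \det B = 0.
Proof.
move=> hB /injectivePn[i [j ij e]]; apply: (determinant_alternate ij) => l.
by rewrite !hB e.
Qed.

Lemma det_mxsub_inj (k : nat) (f : 'I_k -> 'I_m) (g : 'I_k -> 'I_n) :
  ~ divides q (\det (mxsub f g A)) -> injective f /\ injective g.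
Proof.
move=> ndvd; split; apply/injectiveP; apply: contra_notT ndvd => ninj.
  rewrite (@det_row_inj _ _ _ f (fun i l => A i (g l))) => [||//]; first exact: divides0.
  by move=> i j; rewrite mxE.
rewrite -det_tr (@det_row_inj _ _ _ g (fun i l => A (f l) i)) => [||//]; first exact: divides0.
by move=> i j; rewrite !mxE.
Qed.

Hypothesis minors : forall x, is_maximal_minor A x -> divides q x.

(** Repeated indices give determinant 0; otherwise sorting the columns and permuting the rows
    changes a maximal minor only by a sign. *)
Lemma divides_maximal_minor (f : 'I_m -> 'I_m) (g : 'I_m -> 'I_n) :
  divides q (\det (mxsub f g A)).
Proof.
apply: contrapT => ndvd; have [finj ginj] := det_mxsub_inj ndvd; apply: ndvd.
pose B := [set g i | i : 'I_m].
have cardB : #|B| = m by rewrite card_imset// card_ord.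
pose h (i : 'I_m) : 'I_n := Order.enum_val (cast_ord (esym cardB) i).
have hB i : exists j, g j = h i.
  have : h i \in B by exact: Order.enum_valP.
  by move=> /imsetP[j _ ->]; exists j.
have h_incr : {homo h : i j / (i < j)%N}.
  move=> i j ij; change (h i < h j)%O.
  by rewrite (leW_mono (Order.le_enum_val (@le_total _ _) (A := B))).
have [s0 gs0] := choice hB.
have s0inj : injective s0.
  move=> i j e; have : h i = h j by rewrite -!gs0 e.
  by move/Order.enum_val_inj/cast_ord_inj.
pose s := perm s0inj; pose u := perm finj.
have -> : mxsub f g A = perm_mx u *m colsub h A *m perm_mx s.
  rewrite -row_permE -[s]invgK -col_permE; apply/matrixP => i j.
  by rewrite !mxE permE -gs0 -[s0 _](permE s0inj) permKV.
rewrite !det_mulmx !det_perm mulrC; do 2 apply: dividesMl.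
by apply: minors; exists h.
Qed.

(* McCoy: take a largest square submatrix whose minor is not divisible by q, and
   adjoin a row. The cofactors along an adjoined column do not depend on that
   column, and combine the rows of A into a vector of larger minors. *)
Lemma row_relation : ~ divides q 1 ->
  exists w : 'rV[S]_m, (exists i, ~ divides q (w ord0 i)) /\
    forall k, divides q ((w *m A) ord0 k).
Proof.
move=> q1.
pose P r := `[< exists (f : 'I_r -> 'I_m) (g : 'I_r -> 'I_n),
  ~ divides q (\det (mxsub f g A)) >].
have P0 : exists r, P r.
  (* The empty minor is 1, which [q] does not divide. *)
  exists 0%N; apply/asboolP.
  exists (fun i : 'I_0 => match i with Ordinal _ h => match notF h with end end).
  exists (fun i : 'I_0 => match i with Ordinal _ h => match notF h with end end).
  by rewrite det_mx00.
(* Injectivity of [f] gives [r <= m], and for [r = m] all minors are divisible by [q]. *)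
have Plt r : P r -> (r < m)%N.
  move=> /asboolP[f [g ndvd]]; have [finj ginj] := det_mxsub_inj ndvd.
  have := leq_card f finj; rewrite !card_ord leq_eqVlt => /orP[/eqP rm|//].
  by case: ndvd; move: f g {finj ginj}; rewrite rm; exact: divides_maximal_minor.
have Pbound r : P r -> (r <= m)%N by move/Plt/ltnW.
case: (ex_maxnP P0 Pbound) => r Pr r_max.
have rm := Plt r Pr; move: Pr => /asboolP[f [g ndvd]].
have [finj _] := det_mxsub_inj ndvd.
have [i0 hi0] : exists i0, forall i, f i != i0.
  have : ~~ [forall i0, i0 \in codom f].
    apply/negP => /forallP h; have := card_codom finj.
    rewrite (eq_card (B := predT)) => [|i]; first by rewrite !card_ord => e; lia.
    by rewrite h.
  rewrite negb_forall => /existsP[i0 h]; exists i0 => i.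
  by apply: contraNneq h => <-; exact: codom_f.
pose f' (i : 'I_r.+1) := if unlift ord_max i is Some j then f j else i0.
pose g' k (i : 'I_r.+1) := if unlift ord_max i is Some j then g j else k.
pose c (i : 'I_r.+1) := (-1) ^+ (i + r) * \det (mxsub (f' \o lift i) g A).
have expand k : \sum_i c i * A (f' i) k = \det (mxsub f' (g' k) A).
  rewrite (expand_det_col _ ord_max); apply: eq_bigr => i _.
  rewrite mxE /g' unlift_none mulrC; congr (_ * _); rewrite /cofactor /c.
  congr (_ * \det _); apply/matrixP => a b; rewrite !mxE.
  by rewrite liftK.
(* Summing over the fibres of [f'] moves [c] from the rows of the submatrix to those of [A], with 0
   elsewhere. *)
exists (\row_j \sum_(i | f' i == j) c i); split; last first.
  move=> k; have -> : ((\row_j \sum_(i | f' i == j) c i) *m A) ord0 k =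
      \det (mxsub f' (g' k) A).
    rewrite -expand mxE (partition_big f' xpredT)//=; apply: eq_bigr => j _.
    rewrite mxE mulr_suml; apply: eq_bigr => i /eqP <- //.
  apply: contrapT => h; suff /r_max : P r.+1 by rewrite ltnn.
  by apply/asboolP; exists f', (g' k).
(* The entry at the adjoined row is, up to sign, the minor chosen as not divisible by [q]. *)
exists i0; rewrite mxE (big_pred1 ord_max) => [h|i]; last first.
  rewrite /f' /=; case: unliftP => [j ->|->]; last by rewrite !eqxx.
  by rewrite (negPf (hi0 j)) [RHS]eq_sym (negPf (neq_lift _ _)).
apply: ndvd; move: h; rewrite /c /= addnn -signr_odd => /divides_sign.
suff -> : mxsub (f' \o lift ord_max) g A = mxsub f g A by [].
by apply/matrixP => a b; rewrite !mxE /= /f' liftK.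
Qed.

End McCoy.

(** * Remainders modulo a polynomial monic at both ends *)

Lemma divides_monomialM (a : int) (x y : laurent) :
  divides (laurent_monomial a * x) y <-> divides x y.
Proof.
split=> -[z ->]; first by exists (laurent_monomial a * z); ring.
exists (laurent_monomial (- a) * z).
transitivity (laurent_monomial (- a) * laurent_monomial a * (x * z)); last by ring.
by rewrite laurent_monomialNK mul1r.
Qed.

(** Since [t] does not divide [p], powers of [t] cancel from [t^n r = p Y], and sizes then force
    [r = 0]. *)
Lemma divides_small_poly (p r : {poly int}) : p`_0 != 0 -> (size r < size p)%N ->
  divides (laurent_of_poly p) (laurent_of_poly r) -> r = 0.
Proof.
move=> p0 sr [y]; have [n [Y ->]] := laurentE y => e.
have pN0 : p != 0 by apply: contraNneq p0 => ->; rewrite coef0.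
have {e}: 'X^n * r = p * Y.
  apply: laurent_of_poly_inj; rewrite !rmorphM /= e -laurent_monomial_nat.
  rewrite mulrCA [_ * (_ * laurent_of_poly Y)]mulrA.
  by rewrite [laurent_monomial n * _]mulrC laurent_monomialNK mul1r.
elim: n Y => [|n IH] Y.
  rewrite mul1r => e; apply/eqP; apply: contraTT sr => r0.
  have Y0 : Y != 0 by apply: contraNneq r0 => Y0; rewrite e Y0 mulr0.
  rewrite e size_mul// -leqNgt; move: Y0; rewrite -size_poly_gt0.
  by case: (size Y) => // k _; rewrite addnS leq_addr.
move=> e; have /factor_theorem[Y' eY] : root Y 0.
  have := congr1 (fun s : {poly int} => s`_0) e.
  rewrite coefXnM coef0M /= rootE horner_coef0 => /esym/eqP.
  by rewrite mulf_eq0 (negPf p0).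
apply: (IH Y'); apply: (@mulIf _ 'X); first by rewrite polyX_eq0.
by rewrite subr0 in eY; rewrite -[RHS]mulrA -eY -e exprS -mulrA [RHS]mulrC.
Qed.

Section Remainder.
Variables (q : laurent).
Hypotheses (q_nonconst : nonconstant q) (q_monic : monic_at_both_ends q).

Lemma monic_not_divides1 : ~ divides q 1.
Proof.
have [a [p [-> sp p0 _]]] := monic_at_both_endsP q_nonconst q_monic.
rewrite divides_monomialM -(rmorph1 laurent_of_poly) => /divides_small_poly.
rewrite -normr_eq0 p0 size_poly1 => /(_ isT sp)/eqP.
by rewrite oner_eq0.
Qed.

(** Remainders modulo [q] identify the quotient with polynomials of bounded size; [psi] reads off
    the coefficient at the degree of the remainder of [x]. *)
Lemma laurent_quotient_functional (x : laurent) : ~ divides q x ->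
  exists psi : {additive laurent -> int}, (forall y, psi (q * y) = 0) /\ psi x != 0.
Proof.
have [a [p [eq sp p0 pl]]] := monic_at_both_endsP q_nonconst q_monic.
pose P := laurent_of_poly p.
have dvdq y : divides q y <-> divides P y by rewrite eq; exact: divides_monomialM.
have p_unit : lead_coef p \is a GRing.unit by lia.
have pN0 : p != 0 by rewrite -size_poly_gt0; lia.
have red_neg n Q : exists Q', divides P
    (laurent_monomial (- n%:Z) * laurent_of_poly Q - laurent_of_poly Q').
  elim: n Q => [|n IH] Q.
    by exists Q; rewrite oppr0 laurent_monomial0 mul1r subrr; exact: divides0.
  have /factor_theorem[p' hp'] : root (p - (p`_0)%:P) 0.
    by rewrite rootE hornerD hornerN hornerC horner_coef0 subrr.
  rewrite subr0 in hp'.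
  have p01 : (p`_0)%:P * (p`_0)%:P = 1 :> {poly int}.
    by rewrite -polyCM -[RHS]polyC1; congr _%:P; lia.
  (* [u] is the inverse of [t] modulo [p]; it exists because the constant coefficient is its own
     inverse. *)
  pose u := - p' * (p`_0)%:P.
  have hu : 1 = (p`_0)%:P * p + 'X * u.
    rewrite /u -p01; transitivity ((p`_0)%:P * (p - p' * 'X)); last by ring.
    by rewrite -hp' opprB addrC subrK.
  have [Q' hQ'] := IH (u * Q); exists Q'.
  pose m := laurent_monomial (- n.+1%:Z).
  have eX : m * laurent_of_poly 'X = laurent_monomial (- n%:Z).
    rewrite -['X]expr1 -laurent_monomial_nat -laurent_monomialD.
    by congr laurent_monomial; lia.
  have -> : m * laurent_of_poly Q =
      m * laurent_of_poly Q * laurent_of_poly (p`_0)%:P * P +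
      laurent_monomial (- n%:Z) * laurent_of_poly (u * Q).
    rewrite -eX -{1}[Q]mul1r {1}hu rmorphM rmorphD !rmorphM /= -/P; ring.
  rewrite -addrA; apply: dividesD => //; apply: dividesMl.
  by exists 1; rewrite mulr1.
have red y : exists r : {poly int}, (size r < size p)%N /\
    divides P (y - laurent_of_poly r).
  have [n [Q ->]] := laurentE y; have [Q' hQ'] := red_neg n Q.
  exists (Q' %% p); split; first exact: Pdiv.Idomain.ltn_modpN0.
  rewrite -(subrKA (laurent_of_poly Q')); apply: dividesD => //.
  rewrite -rmorphB {1}(Pdiv.IdomainUnit.divp_eq p_unit Q') addrK rmorphM /=.
  by apply: dividesMl; exists 1; rewrite mulr1.
have uniq0 (r : {poly int}) : (size r < size p)%N -> divides P (laurent_of_poly r) ->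
    r = 0.
  by apply: divides_small_poly; rewrite -normr_eq0 p0.
pose rem y := sval (cid (red y)).
have rem_size y : (size (rem y) < size p)%N by rewrite /rem; case: cid => ? [].
have rem_div y : divides P (y - laurent_of_poly (rem y)) by rewrite /rem; case: cid => ? [].
(* Remainders are unique, so choosing them pointwise still gives an additive map. *)
have remB : zmod_morphism rem.
  move=> y z; apply/eqP; rewrite -subr_eq0; apply/eqP; apply: uniq0.
    apply: leq_ltn_trans (size_polyD _ _) _; rewrite size_polyN gtn_max rem_size /=.
    by apply: leq_ltn_trans (size_polyD _ _) _; rewrite size_polyN gtn_max !rem_size.
  have -> : laurent_of_poly (rem (y - z) - (rem y - rem z)) =
     (y - laurent_of_poly (rem y)) - (z - laurent_of_poly (rem z))
     - ((y - z) - laurent_of_poly (rem (y - z))).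
    by rewrite !rmorphB /=; ring.
  by apply: dividesB => //; exact: dividesB.
move=> ndvd; have rx0 : rem x != 0.
  apply/eqP => r0; apply: ndvd; apply/dvdq; have := rem_div x.
  by rewrite r0 rmorph0 subr0.
pose psi y := (rem y)`_(size (rem x)).-1.
have psiB : zmod_morphism psi by move=> y z; rewrite /psi remB coefB.
pose psiA : {additive laurent -> int} :=
  HB.pack psi (GRing.isZmodMorphism.Build _ _ psi psiB).
exists psiA; split; last by rewrite /= /psi -lead_coefE lead_coef_eq0.
move=> y; rewrite /= /psi; suff -> : rem (q * y) = 0 by rewrite coef0.
apply: uniq0 => //.
have -> : laurent_of_poly (rem (q * y)) = q * y - (q * y - laurent_of_poly (rem (q * y))).
  by rewrite subKr.
by apply: dividesB => //; apply/dvdq; exists y.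
Qed.

End Remainder.

(** * Homomorphisms to the integers *)

Section HomToInt.
Variables (K : groupType) (f : K -> int).
Hypothesis fM : {morph f : x y / (x * y)%g >-> x + y}.

Let f1 : f 1%g = 0.
Proof. by apply: (addrI (f 1%g)); rewrite -fM mulg1 addr0. Qed.

Let fV x : f x^-1%g = - f x.
Proof. by apply: (addrI (f x)); rewrite -fM mulgV f1 subrr. Qed.

Lemma hom_int_derived (x : K) : x \in derived K -> f x = 0.
Proof.
pose ker : {pred K} := fun x => f x == 0.
have hM : mulg_closed ker.
  by move=> u v /eqP hu /eqP hv; apply/eqP; rewrite fM hu hv addr0.
have h1 : 1%g \in ker by apply/eqP; exact: f1.
have hV : invg_closed ker by move=> u /eqP hu; apply/eqP; rewrite fV hu oppr0.
pose S : groupClosed K := HB.pack ker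
  (isMulClosed.Build K ker hM) (isMul1Closed.Build K ker h1)
  (isInvClosed.Build K ker hV).
rewrite unfold_in => /asboolP/(_ S) h; apply/eqP; apply: h => a b.
by apply/eqP; rewrite /commg /conjg !(fM, fV); ring.
Qed.

Lemma hom_int_abelianisation :
  exists F : {additive abelianisation K -> int}, forall x, F (ab x) = f x.
Proof.
have repr_ab x : f (repr (ab x)) = f x.
  have /hom_int_derived : (x^-1 * repr (ab x))%g \in derived K.
    by apply/abP; rewrite abK.
  by rewrite fM fV => /eqP; rewrite addrC subr_eq0 => /eqP.
pose F (u : abelianisation K) := f (repr u).
have FD : {morph F : u v / u + v}.
  by move=> u v; rewrite -[u]abK -[v]abK -abM /F !repr_ab fM.
have FB : zmod_morphism F.
  by move=> u v; apply/eqP; rewrite eq_sym subr_eq -FD subrK.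
pose FA : {additive abelianisation K -> int} :=
  HB.pack F (GRing.isZmodMorphism.Build _ _ F FB).
by exists FA => x; rewrite /= /F.
Qed.

(** The image is generated by its least positive element [k], since remainders modulo [k] are again
    values of [f]; dividing by [k] makes the map onto. *)
Lemma hom_int_surjective (x0 : K) : f x0 != 0 ->
  exists g : K -> int,
    {morph g : x y / (x * y)%g >-> x + y} /\ (forall z, exists x, g x = z).
Proof.
move=> fx0.
pose P k := (0 < k)%N && `[< exists x, f x = k%:Z >].
have exP : exists k, P k.
  exists `|f x0|%N; rewrite /P absz_gt0 fx0 /=; apply/asboolP.
  have [h|h] := leP 0 (f x0); first by exists x0; lia.
  by exists x0^-1%g; rewrite fV; lia.
have [k /andP[k0 /asboolP[x1 fx1]] kmin] := ex_minnP exP.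
have fX x (n : nat) : f (x ^+ n)%g = f x *+ n.
  by elim: n => [|n IH]; rewrite ?expg0 ?f1// expgS fM IH mulrS.
have fZ x (z : int) : exists y, f y = f x * z.
  case: z => n; first by exists (x ^+ n)%g; rewrite fX -mulr_natr natz.
  by exists (x ^+ n.+1)^-1%g; rewrite fV fX NegzE -mulr_natr natz mulrN.
have kdvd x : (k%:Z %| f x)%Z.
  have [y fy] := fZ x1 (- (f x %/ k%:Z)%Z).
  have e : f (x * y)%g = (f x %% k%:Z)%Z.
    by rewrite fM fy fx1 {1}(divz_eq (f x) k%:Z); ring.
  have k0' : k%:Z != 0 by lia.
  apply/dvdz_mod0P/eqP; apply: contraT => r0.
  have r1 := modz_ge0 (f x) k0'; have r2 := ltz_pmod (f x) (_ : 0 < k%:Z).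
  suff /kmin : P `|(f x %% k%:Z)%Z|%N by move: (r2 k0); lia.
  rewrite /P absz_gt0 r0 /=; apply/asboolP; exists (x * y)%g; rewrite e; lia.
exists (fun x => (f x %/ k%:Z)%Z); split=> [x y|z].
  by rewrite fM divzDl.
have [y fy] := fZ x1 z; exists y; rewrite fy fx1 mulrC mulzK//; lia.
Qed.

End HomToInt.

(** * Minors and functionals of a presented module *)

Section Presentation.
Variables (S : comNzRingType) (M : lmodType S) (m n : nat) (A : 'M[S]_(m, n)).
Hypothesis A_pres : is_presentation M A.

(** The adjugate of the chosen square block writes [x] times any vector as a combination of columns
    of [A]. *)
Lemma maximal_minor_kills (x : S) (u : M) : is_maximal_minor A x -> x *: u = 0.
Proof.
have [phi [phi_surj phi_ker]] := A_pres; move=> [f _ ->]; have [v <-] := phi_surj u.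
rewrite -linearZ /=; apply/phi_ker.
exists (colsub f 1%:M *m (\adj (colsub f A) *m v)).
by rewrite !mulmxA mulmx_colsub mulmx1 mul_mx_adj mul_scalar_mx.
Qed.

(* Row relations modulo q are homomorphisms from M to S / q, which are here lifted
   to maps into S that are only additive modulo q. *)
Lemma presentation_functional (q : S) (w : 'rV[S]_m) (i : 'I_m)
    (psi : {additive S -> int}) :
  (forall k, divides q ((w *m A) ord0 k)) ->
  (forall y, psi (q * y) = 0) -> psi (w ord0 i) != 0 ->
  exists F : {additive M -> int}, exists u, F u != 0.
Proof.
have [phi [phi_surj phi_ker]] := A_pres => wA psiq psiw.
(* [s] is only a set-theoretic section; additivity of [F] comes from [psi_wd]. *)
have [s hs] := choice phi_surj.
have psi_wd v v' : phi v = phi v' ->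
    psi ((w *m v) ord0 ord0) = psi ((w *m v') ord0 ord0).
  move=> e; have /phi_ker[c hc] : phi (v - v') = 0 by rewrite raddfB /= e subrr.
  apply/eqP; rewrite -subr_eq0 -raddfB /=.
  have -> : (w *m v) ord0 ord0 - (w *m v') ord0 ord0 = ((w *m A) *m c) ord0 ord0.
    by rewrite -mulmxA -hc mulmxBr !mxE.
  suff [y ->] : divides q ((w *m A *m c) ord0 ord0) by rewrite psiq.
  rewrite mxE; elim/big_ind: _ => [|x y|k _]; [exact: divides0|exact: dividesD|].
  by rewrite mulrC; exact: dividesMl.
pose F u := psi ((w *m s u) ord0 ord0).
have FB : zmod_morphism F.
  move=> u v; rewrite /F -raddfB /=.
  have -> : (w *m s u) ord0 ord0 - (w *m s v) ord0 ord0 = (w *m (s u - s v)) ord0 ord0.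
    by rewrite mulmxBr !mxE.
  by apply: psi_wd; rewrite raddfB /= !hs.
pose FA : {additive M -> int} := HB.pack F (GRing.isZmodMorphism.Build _ _ F FB).
exists FA, (phi (delta_mx i ord0)); rewrite /= /F (psi_wd _ (delta_mx i ord0)) ?hs//.
by rewrite -colE mxE.
Qed.

End Presentation.

(** * The two implications, for any group with an Alexander polynomial *)

Section Main.
Variables (G : groupType) (Delta : laurent).
Hypothesis hDelta : is_alexander_polynomial G Delta.

Lemma monic_factor_of_hom (f : commutator_subgroup G -> int) :
  {morph f : x y / (x * y)%g >-> x + y} -> (exists x, f x != 0) ->
  exists q, [/\ divides q Delta, nonconstant q & monic_at_both_ends q].
Proof.
move=> fM [x1 fx1].
have [t [_ [m [n [A [_ A_pres [Delta_dvd Delta_hcf]]]]]]] := hDelta.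
have [F FE] := hom_int_abelianisation fM.
pose v : alexander_module t := ab x1.
pose phi (x : laurent) : int := F (x *: v).
have phiB : zmod_morphism phi by move=> x y; rewrite /phi scalerBl raddfB.
pose phiA : {additive laurent -> int} :=
  HB.pack phi (GRing.isZmodMorphism.Build _ _ phi phiB).
have minor_ann x : is_maximal_minor A x -> annihilates phiA x.
  move=> hx h; rewrite /= /phi -scalerA (maximal_minor_kills A_pres _ hx) scaler0.
  exact: raddf0.
have [[x hx x0]|allz] := pselect (exists2 x, is_maximal_minor A x & x != 0).
  have [|q [q1 q2 q3]] := @annihilator_generator phiA x x0 (minor_ann _ hx).
    by rewrite /= /phi scale1r FE.
  by exists q; split=> //; apply: Delta_hcf => y /minor_ann/q3.
have D0 : Delta = 0.
  (* When all minors vanish, 0 is a common divisor of them and so divides [Delta]. *)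
  have [|y ->] := Delta_hcf 0; last by rewrite mul0r.
  move=> x hx; have [->|x0] := eqVneq x 0; first exact: divides0.
  by case: allz; exists x.
pose p : {poly int} := 'X - 1%:P.
have s2 : size p = 2 by rewrite size_XsubC.
have p0 : p`_0 = -1 by rewrite coefB coefX coefC.
exists (laurent_of_poly p); split.
- by rewrite D0; exact: divides0.
- by apply: nonconstant_poly; rewrite ?p0 ?s2.
- by apply: monic_at_both_ends_poly; rewrite ?p0 ?normrN ?normr1// lead_coefXsubC normr1.
Qed.

Lemma hom_of_monic_factor (q : laurent) :
  divides q Delta -> nonconstant q -> monic_at_both_ends q ->
  exists f : commutator_subgroup G -> int,
    {morph f : x y / (x * y)%g >-> x + y} /\ (forall z, exists x, f x = z).
Proof.
move=> [y Dq] q_nc q_m.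
have [t [_ [m [n [A [_ A_pres [Delta_dvd _]]]]]]] := hDelta.
have minors x : is_maximal_minor A x -> divides q x.
  by move=> /Delta_dvd[z ->]; exists (y * z); rewrite Dq mulrA.
have q1 : ~ divides q 1.
  exact: monic_not_divides1.
have [w [[i wi] wA]] := row_relation minors q1.
have [psi [psiq psiw]] := laurent_quotient_functional q_nc q_m wi.
have [F [u Fu]] := presentation_functional A_pres wA psiq psiw.
apply: (@hom_int_surjective _ (fun x => F (ab x)) _ (repr u)).
  by move=> a b; rewrite abM raddfD.
by rewrite abK.
Qed.

End Main.

Theorem theorem3p2 (R : realType) (k : knot R) (x0 : complement k)
    (Delta : laurent)
    (hDelta : is_alexander_polynomial (knot_group x0) Delta) :
  (exists f : commutator_subgroup (knot_group x0) -> int,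
      {morph f : x y / (x * y)%g >-> x + y} /\ (forall z, exists x, f x = z))
  <->
  (exists q : laurent,
      [/\ divides q Delta, nonconstant q & monic_at_both_ends q]).
Proof.
split=> [[f [fM f_surj]]|[q [qD q_nc q_m]]].
  apply: (monic_factor_of_hom hDelta fM).
  by have [x fx] := f_surj 1; exists x; rewrite fx.
exact: (hom_of_monic_factor hDelta qD).
Qed.
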